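(* Let $k,n$ be positive integers with $n>2k$ and let $q>k$. Let $\rho\in C^2(0,\infty)\cap C[0,\infty)$ with $\rho(r)>0$ for $r>0$, put $R(r)=r\rho'(r)/\rho(r)$, and assume: (a) the finite limit $l_0=\lim_{r\to 0}R(r)$ exists, and either [$l_0>R(r)$ for all $r>0$ and $q\ge q^*(k,l_0)$] or [$l_0\ge R(r)$ for all $r>0$ and $q>q^*(k,l_0)$]; (b) there is a constant $L>0$ such that $K(r):=r^{-l_0}\rho(r)$ satisfies $0<K(r)<L$ for all $r>0$. Let $(x(t),y(t))$ be a trajectory of the system $$\dot x=x(\nu(t)-x-qy),\qquad \dot y=y\left(-\frac{n-2k}{k}+\frac xk+y\right),\qquad \nu(t)=n+R(e^t),$$ of class $C^1$ near $t=-\infty$ (and continued as a solution of the system), such that $(x(t),y(t))\to(\hat x,\hat y)$ as $t\to-\infty$, where $$(\hat x,\hat y)=\left(\frac{q(n-2k)-k(n+l_0)}{q-k},\ \frac{2k+l_0}{q-k}\right).$$ Then for $$\lambda=\tilde\lambda:=\frac{c_{n,k}\,x(0)\,y(0)^k}{\rho(1)}$$ the problem $(P_\lambda)$ possesses a singular solution $\tilde u$ with the following asymptotic representation as $r\to0$: $$\tilde u(r)=-\left(\frac{c_{n,k}\hat x\hat y^k}{\tilde\lambda K(0)}\right)^{\frac1{q-k}}r^{-\frac{2k+l_0}{q-k}}(1+o(1)).$$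
   Context: Notation: $q^*(k,\sigma)=\frac{(n+2)k+\sigma(k+1)}{n-2k}$, $c_{n,k}=\binom nk/n$. $K(0):=\lim_{r\to0}K(r)$, which exists and is positive under the assumptions. Equation of $(P_\lambda)$: $c_{n,k}r^{1-n}\left(r^{n-k}(u')^k\right)'=\lambda\rho(r)(1-u)^q$ for $0<r<1$, with $u<0$ on $(0,1)$ and $u(1)=0$. A singular solution of $(P_\lambda)$ is a function satisfying these relations for $0<r<1$ (and $u(1)=0$) with $u(r)\to-\infty$ as $r\to0$. *)

(* Defs.v *)
From Stdlib Require Import Reals Lra ZArith.
From Coquelicot Require Import Coquelicot.
Open Scope R_scope.

(* [Binomial.C] is the real-valued binomial coefficient; the unqualified [C] is
   Coquelicot's type of complex numbers. *)
Definition c_nk (n k : nat) : R := Binomial.C n k / INR n.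

Definition q_star (n k : nat) (sigma : R) : R :=
  ((INR n + 2) * INR k + sigma * (INR k + 1)) / (INR n - 2 * INR k).

Definition C2_pos (f : R -> R) : Prop :=
  forall r, 0 < r -> forall m : nat, (m <= 2)%nat ->
    ex_derive_n f m r /\ continuous (Derive_n f m) r.

Definition rho_R (rho : R -> R) (r : R) : R := r * Derive rho r / rho r.

(* [Rpower] is the real power only for a positive base, here [0 < r]. *)
Definition rho_K (rho : R -> R) (l0 r : R) : R := Rpower r (- l0) * rho r.

Definition nu (n : nat) (rho : R -> R) (t : R) : R := INR n + rho_R rho (exp t).

(* Solutions on the open interval (-oo, T).  When [nu] is continuous, such an
   [(x, y)] is automatically of class C^1 there. *)
Definition solves_system (n k : nat) (q : R) (rho x y : R -> R) (T : Rbar) : Prop :=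
  forall t : R, Rbar_lt t T ->
    is_derive x t (x t * (nu n rho t - x t - q * y t)) /\
    is_derive y t
      (y t * (- ((INR n - 2 * INR k) / INR k) + x t / INR k + y t)).

(* A solution continued to the right as far as possible, so that (-oo, T) is
   its maximal interval of existence; [T = p_infty] is allowed. *)
Definition maximal_trajectory
    (n k : nat) (q : R) (rho x y : R -> R) (T : Rbar) : Prop :=
  Rbar_lt m_infty T /\
  solves_system n k q rho x y T /\
  forall (T' : Rbar) (x' y' : R -> R),
    Rbar_lt T T' ->
    solves_system n k q rho x' y' T' ->
    ~ (forall t : R, Rbar_lt t T -> x' t = x t /\ y' t = y t).

Definition x_hat (n k : nat) (q l0 : R) : R :=
  (q * (INR n - 2 * INR k) - INR k * (INR n + l0)) / (q - INR k).

Definition y_hat (k : nat) (q l0 : R) : R := (2 * INR k + l0) / (q - INR k).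

(* The quantity [r^(n-k) (u')^k] under the outer derivative. *)
Definition flux (n k : nat) (u : R -> R) (r : R) : R :=
  r ^ (n - k) * Derive u r ^ k.

(* Since the equation is only imposed on (0,1), continuity on (0,1] is what ties
   the boundary value [u 1 = 0] to the solution inside. *)
Definition solves_P (n k : nat) (q : R) (rho : R -> R) (lambda : R)
    (u : R -> R) : Prop :=
  (forall r, 0 < r < 1 ->
     ex_derive u r /\
     ex_derive (flux n k u) r /\
     c_nk n k * powerRZ r (1 - Z.of_nat n) * Derive (flux n k u) r
       = lambda * rho r * Rpower (1 - u r) q /\
     u r < 0) /\
  continuous_on (fun r => 0 < r <= 1) u /\
  u 1 = 0.

Definition singular_solution (n k : nat) (q : R) (rho : R -> R) (lambda : R)
    (u : R -> R) : Prop :=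
  solves_P n k q rho lambda u /\
  filterlim u (at_right 0) (Rbar_locally m_infty).

Definition lambda_tilde (n k : nat) (rho x y : R -> R) : R :=
  c_nk n k * x 0 * y 0 ^ k / rho 1.

(* Main.v *)
Require Import Defs.
From Stdlib Require Import Reals Lra Lia ZArith.
From Coquelicot Require Import Coquelicot.
Open Scope R_scope.

(** The planar system is the equation of the problem in the variables
    [t = ln r], [y = r u' / w], [x = r^n lambda rho w^q / (c r^(n-k) (u')^k)],
    where [w = 1 - u] and [c = c_nk n k]. These relations give
    [c x y^k = lambda r^(2k) rho w^(q-k)], so [w] can be read off from [x], [y]
    and [r] algebraically:
    [w = (c x y^k / (lambda r^(2k) rho))^(1/(q-k))]. Differentiating this formula
    along the system yields [w' = - w y / r] ([log_w_derive]) and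
    [(r^(n-k) (u')^k)' = r^(n-k) (u')^k x / r] ([flux_sol_derive]), which is the
    equation ([sol_equation]); the value [lambda_tilde] of the parameter is the
    one for which [w 1 = 1], that is [u 1 = 0]. Since [x], [y] and
    [K = r^(-l0) rho] converge to positive limits as [r] tends to [0], the
    formula for [w] also yields the asymptotic representation, and
    [(2k + l0) / (q - k) > 0] makes the solution singular.

    All this requires the trajectory to exist on the whole line. Let
    [b = (n - 2k) / (k + 1)] and [G = k y / (k + 1) + x / (q + 1) - b]; up to the
    positive factor [r^(n-k) (u')^k w] this is the Pohozaev function. It satisfies
    [G' = (y - x) G + x (nu / (q + 1) - b)], and [R <= l0] together with
    [q >= q_star] gives [nu / (q + 1) <= b], so [G' <= (y - x) G]. At the limit
    point [G] equals [- (1/(k+1) - 1/(q+1)) x_hat < 0], hence [G < 0] throughout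
    ([pohozaev_neg]). In the same way [x] and [y] stay positive, and [G < 0] then
    bounds both ([trajectory_bounded]). A bounded trajectory on a half-line
    ending at a finite [T] has limits at [T], because its derivative is bounded,
    and is prolonged beyond [T] by the Picard-Lindelof theorem
    ([lotka_volterra_continue]); so the maximal time is infinite
    ([trajectory_global]).

    Finally [K' = K (R - l0) / r <= 0], so the bounded function [K] increases to a
    positive limit as [r] decreases to [0], and the continuity of [rho] at [0]
    forces [l0 >= 0]. *)

(** * Local existence for ordinary differential equations *)

Lemma abs_RInt_le_bound (f : R -> R) (a b M : R)
  (hf : ex_RInt f a b)
  (hM : forall t, Rmin a b <= t <= Rmax a b -> Rabs (f t) <= M) :
  Rabs (RInt f a b) <= Rabs (b - a) * M.
Proof.
  destruct (Rle_dec a b) as [hab | hab].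
  - rewrite Rmin_left, Rmax_right in hM by lra.
    rewrite (Rabs_pos_eq (b - a)) by lra.
    now apply abs_RInt_le_const.
  - rewrite Rmin_right, Rmax_left in hM by lra.
    rewrite <- opp_RInt_swap by now apply ex_RInt_swap.
    change (Rabs (- RInt f b a) <= Rabs (b - a) * M).
    rewrite Rabs_Ropp, (Rabs_left1 (b - a)) by lra.
    replace (- (b - a)) with (a - b) by ring.
    apply abs_RInt_le_const; [lra | now apply ex_RInt_swap | exact hM].
Qed.

Lemma RInt_derive (f : R -> R) (a t : R) (hf : forall s, continuous f s) :
  is_derive (fun s => RInt f a s) t (f t).
Proof.
  apply is_derive_RInt with a; [| apply hf].
  apply filter_forall; intro b.
  apply RInt_correct, ex_RInt_continuous; intros; apply hf.
Qed.

Lemma continuous_of_derive (f : R -> R) (t l : R) :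
  is_derive f t l -> continuous f t.
Proof. intro h; apply (ex_derive_continuous (K := R_AbsRing) (V := R_NormedModule)); now exists l. Qed.

Lemma geometric_vanishes (a : R) : is_lim_seq (fun n => a * (1 / 2) ^ n) 0.
Proof.
  replace (Finite 0) with (Rbar_mult a 0) by (simpl; f_equal; ring).
  apply is_lim_seq_scal_l, is_lim_seq_geom.
  rewrite Rabs_pos_eq; lra.
Qed.

Lemma geometric_limit (u : nat -> R) (M : R)
  (hu : forall n, Rabs (u (S n) - u n) <= M * (1 / 2) ^ n) (n : nat) :
  Rabs (real (Lim_seq u) - u n) <= 2 * M * (1 / 2) ^ n.
Proof.
  assert (hM : 0 <= M).
  { specialize (hu 0%nat); simpl in hu; pose proof (Rabs_pos (u 1%nat - u 0%nat)); lra. }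
  assert (htail : forall n p, Rabs (u (n + p)%nat - u n) <= 2 * M * (1 / 2) ^ n).
  { clear n; intros n p.
    assert (h : Rabs (u (n + p)%nat - u n)
                <= 2 * M * ((1 / 2) ^ n - (1 / 2) ^ (n + p))).
    { induction p as [| p IH].
      - rewrite Nat.add_0_r, !Rminus_diag, Rabs_R0; lra.
      - rewrite Nat.add_succ_r; simpl.
        specialize (hu (n + p)%nat).
        replace (u (S (n + p)) - u n)
          with ((u (S (n + p)) - u (n + p)%nat) + (u (n + p)%nat - u n)) by ring.
        eapply Rle_trans; [apply Rabs_triang | lra]. }
    pose proof (pow_lt (1 / 2) (n + p) ltac:(lra)) as hp.
    pose proof (Rmult_le_pos _ _ hM (Rlt_le _ _ hp)); lra. }
  assert (hlim : ex_finite_lim_seq u).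
  { apply ex_lim_seq_cauchy_corr; intro eps.
    pose proof (geometric_vanishes (2 * M)) as hpow.
    apply is_lim_seq_spec in hpow; destruct (hpow eps) as [N hN].
    assert (key : forall n m, (N <= n)%nat -> (n <= m)%nat -> Rabs (u n - u m) < eps).
    { intros i j hi hj.
      rewrite Rabs_minus_sym.
      replace j with (i + (j - i))%nat by lia.
      eapply Rle_lt_trans; [apply htail |].
      specialize (hN i hi); rewrite Rminus_0_r in hN.
      eapply Rle_lt_trans; [apply Rle_abs | exact hN]. }
    exists N; intros i j hi hj.
    destruct (Nat.le_ge_cases i j); [now apply key |].
    rewrite Rabs_minus_sym; now apply key. }
  apply Lim_seq_correct' in hlim.
  assert (hd : is_lim_seq (fun p => Rabs (u (p + n)%nat - u n))
                 (Rabs (real (Lim_seq u) - u n))).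
  { apply (is_lim_seq_abs _ (Finite (real (Lim_seq u) - u n))).
    apply is_lim_seq_minus'; [now apply is_lim_seq_incr_n | apply is_lim_seq_const]. }
  refine (is_lim_seq_le _ _ (Finite _) (Finite _) _ hd (is_lim_seq_const _)).
  intro p; rewrite Nat.add_comm; apply htail.
Qed.

(** The Picard-Lindelof theorem for a system whose components are indexed by an
    arbitrary type [I]; a state is a function [I -> R], and the Lipschitz and
    boundedness hypotheses are uniform in the component, i.e. they refer to the
    sup norm. Continuity of the field is only asked for along continuous curves,
    which is what the integral equation uses. *)
Section Picard.
Variables (I : Type) (F : I -> R -> (I -> R) -> R) (t0 : R) (z0 : I -> R) (L M : R).
Hypothesis F_cont : forall i (Z : I -> R -> R) s,
  (forall j, continuous (Z j) s) -> continuous (fun s => F i s (fun j => Z j s)) s.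
Hypothesis F_lip : forall i s z z' B, Rabs (s - t0) <= 1 ->
  (forall j, Rabs (z j - z' j) <= B) -> Rabs (F i s z - F i s z') <= L * B.
Hypothesis F_bound : forall i s, Rabs (s - t0) <= 1 -> Rabs (F i s z0) <= M.
Hypothesis L_pos : 0 <= L.

(** The Picard iterates, starting from the constant curve [z0]. *)
Fixpoint picard_iter (m : nat) (i : I) (t : R) : R :=
  match m with
  | O => z0 i
  | S m => z0 i + RInt (fun s => F i s (fun j => picard_iter m j s)) t0 t
  end.

Lemma picard_iter_continuous m i t : continuous (picard_iter m i) t.
Proof.
  revert i t; induction m as [| m IH]; intros i t.
  - apply continuous_const.
  - apply (continuous_plus (V := R_NormedModule)).
    + apply continuous_const.
    + eapply continuous_of_derive, RInt_derive.
      intro s; apply F_cont; intro j; apply IH.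
Qed.

Lemma picard_iter_derive m i t :
  is_derive (picard_iter (S m) i) t (F i t (fun j => picard_iter m j t)).
Proof.
  simpl.
  rewrite <- (Rplus_0_l (F i t _)).
  apply (is_derive_plus (K := R_AbsRing) (V := R_NormedModule) (fun _ => z0 i)).
  - exact (is_derive_const (K := R_AbsRing) (V := R_NormedModule) (z0 i) t).
  - apply (RInt_derive (fun s => F i s (fun j => picard_iter m j s))).
    intro s; apply F_cont; intro j; apply picard_iter_continuous.
Qed.

(** On a time interval of half-length [d] with [d * L <= 1 / 2] the Picard operator
    contracts by the factor [1 / 2]. *)
Lemma picard_iter_step d m i t (hd1 : d <= 1) (hdL : d * L <= 1 / 2) :
  Rabs (t - t0) <= d ->
  Rabs (picard_iter (S m) i t - picard_iter m i t) <= M * (1 / 2) ^ m.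
Proof.
  revert i t; induction m as [| m IH]; intros i t ht.
  - simpl.
    rewrite Rplus_minus_l.
    assert (hM : 0 <= M).
    { eapply Rle_trans; [apply Rabs_pos | apply (F_bound i t)]; lra. }
    eapply Rle_trans; [apply abs_RInt_le_bound with (M := M) |].
    + apply (ex_RInt_continuous (V := R_CompleteNormedModule)); intros s _.
      apply (F_cont i (fun j _ => z0 j)); intro j; apply continuous_const.
    + intros s hs; apply F_bound.
      revert hs ht; unfold Rmin, Rmax, Rabs; repeat destruct Rle_dec;
        repeat destruct Rcase_abs; lra.
    + nra.
  - set (g := fun m s => F i s (fun j => picard_iter m j s)).
    assert (hg : forall m, ex_RInt (g m) t0 t).
    { intro p; apply (ex_RInt_continuous (V := R_CompleteNormedModule)); intros s _; apply F_cont.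
      intro j; apply picard_iter_continuous. }
    change (Rabs (z0 i + RInt (g (S m)) t0 t - (z0 i + RInt (g m) t0 t))
            <= M * (1 / 2) ^ S m).
    replace (z0 i + RInt (g (S m)) t0 t - (z0 i + RInt (g m) t0 t))
      with (minus (RInt (g (S m)) t0 t) (RInt (g m) t0 t))
      by (unfold minus, plus, opp; simpl; lra).
    rewrite <- RInt_minus by auto.
    eapply Rle_trans;
      [apply abs_RInt_le_bound with (M := L * (M * (1 / 2) ^ m)) |].
    + apply (ex_RInt_minus (V := R_NormedModule)); auto.
    + intros s hs.
      assert (hs' : Rabs (s - t0) <= d).
      { revert hs ht; unfold Rmin, Rmax, Rabs; repeat destruct Rle_dec;
          repeat destruct Rcase_abs; lra. }
      apply F_lip; [lra |]; intro j; now apply IH.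
    + assert (hM : 0 <= M).
      { eapply Rle_trans; [apply Rabs_pos | apply (F_bound i t)]; lra. }
      pose proof (pow_lt (1 / 2) m ltac:(lra)) as hp.
      pose proof (Rmult_le_pos _ _ hM (Rlt_le _ _ hp)) as hq.
      pose proof (Rabs_pos (t - t0)).
      rewrite <- Rmult_assoc.
      apply Rle_trans with (1 / 2 * (M * (1 / 2) ^ m)); [| simpl; lra].
      apply Rmult_le_compat_r; [exact hq |].
      apply Rle_trans with (d * L); [| exact hdL].
      now apply Rmult_le_compat_r.
Qed.

(** The iterates converge uniformly, and so do their derivatives, since these are
    the values of the field along the preceding iterates; the limit is therefore
    differentiable and solves the system. *)
Lemma picard_lindelof :
  exists d, 0 < d /\ exists Z : I -> R -> R,
    (forall i, Z i t0 = z0 i) /\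
    (forall i t, Rabs (t - t0) < d ->
       is_derive (Z i) t (F i t (fun j => Z j t))).
Proof.
  set (d := / (2 * (L + 1))).
  assert (hd : 0 < d) by (apply Rinv_0_lt_compat; lra).
  assert (hdL : d * (2 * (L + 1)) = 1) by (apply Rinv_l; lra).
  assert (hd1 : d <= 1) by nra.
  assert (hdL' : d * L <= 1 / 2) by lra.
  set (r := mkposreal d hd).
  set (Z := fun i t => real (Lim_seq (fun m => picard_iter m i t))).
  assert (hstep : forall i m t, Rabs (t - t0) < d ->
     Rabs (picard_iter (S m) i t - picard_iter m i t) <= M * (1 / 2) ^ m).
  { intros; apply picard_iter_step with d; lra. }
  assert (htail : forall e, 0 < e -> exists N, forall i m t, (N <= m)%nat ->
            Rabs (t - t0) < d -> Rabs (Z i t - picard_iter m i t) < e).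
  { intros e he.
    pose proof (geometric_vanishes (2 * M)) as hpow.
    apply is_lim_seq_spec in hpow; destruct (hpow (mkposreal e he)) as [N hN].
    exists N; intros i m t hm ht.
    specialize (hN m hm); rewrite Rminus_0_r in hN.
    eapply Rle_lt_trans; [apply (geometric_limit (fun m => picard_iter m i t) M); auto |].
    eapply Rle_lt_trans; [apply Rle_abs | exact hN]. }
  assert (hZ : forall i, CVU (fun m => picard_iter m i) (Z i) t0 r).
  { intros i e he; destruct (htail e he) as [N hN].
    exists N; intros m t hm ht; now apply hN. }
  assert (hZc : forall i t, Rabs (t - t0) < d -> continuity_pt (Z i) t).
  { intros i t ht; apply (CVU_continuity _ _ t0 r (hZ i)); [| exact ht].
    intros m s _; apply continuity_pt_filterlim, picard_iter_continuous. }
  exists d; split; [exact hd |]; exists Z; split.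
  - intro i; unfold Z.
    rewrite (Lim_seq_ext _ (fun _ => z0 i)); [now rewrite Lim_seq_const |].
    intros [| m]; simpl; [reflexivity |].
    rewrite RInt_point; apply Rplus_0_r.
  - intros i t ht; apply is_derive_Reals.
    apply (Ranalysis5.derivable_pt_lim_CVU (fun m => picard_iter (S m) i)
            (fun m s => F i s (fun j => picard_iter m j s))
            (Z i) (fun s => F i s (fun j => Z j s)) t t0 r).
    + exact ht.
    + intros s m _; apply is_derive_Reals, picard_iter_derive.
    + intros s hs e he; destruct (hZ i e he) as [N hN].
      exists N; intros m hm; unfold Rdist.
      rewrite Rabs_minus_sym; apply hN; [lia | exact hs].
    + intros e he.
      destruct (htail (e / (L + 1)) ltac:(apply Rdiv_lt_0_compat; lra)) as [N hN].
      exists N; intros m s hm hs.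
      apply Rle_lt_trans with (L * (e / (L + 1))).
      * apply F_lip; [unfold Boule in hs; simpl in hs; lra |].
        intro j; apply Rlt_le; now apply hN.
      * apply Rlt_le_trans with ((L + 1) * (e / (L + 1))).
        -- apply Rmult_lt_compat_r; [apply Rdiv_lt_0_compat |]; lra.
        -- right; field; lra.
    + intros s hs; apply continuity_pt_filterlim.
      apply (F_cont i Z); intro j; now apply continuity_pt_filterlim, hZc.
Qed.
End Picard.

(** * Linear differential inequalities and one-sided limits *)

Lemma is_derive_integrating_factor (f A : R -> R) (s l m : R) :
  is_derive f s l -> is_derive A s m ->
  is_derive (fun s => f s * exp (- A s)) s ((l - m * f s) * exp (- A s)).
Proof.
  intros hf hA; auto_derive.
  - repeat split; [now exists l | now exists m].
  - replace (Derive (fun x => f x) s) with l by (symmetry; now apply is_derive_unique).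
    replace (Derive (fun x => A x) s) with m by (symmetry; now apply is_derive_unique).
    ring.
Qed.

(** Gronwall: multiplied by [exp (- RInt a t0 t)], the function [f] is
    nonincreasing. *)
Lemma neg_of_linear_inequality (T : Rbar) (f f' a : R -> R) (t0 t : R)
  (ha : forall s : R, Rbar_lt s T -> continuous a s)
  (hf : forall s : R, Rbar_lt s T -> is_derive f s (f' s))
  (hle : forall s : R, Rbar_lt s T -> f' s <= a s * f s)
  (h0 : f t0 < 0) (h0t : t0 <= t) (htT : Rbar_lt t T) :
  f t < 0.
Proof.
  assert (hT : forall s, s <= t -> Rbar_lt s T).
  { intros s hs; apply Rbar_le_lt_trans with t; [exact hs | exact htT]. }
  set (A := fun s => RInt a t0 s).
  assert (hA : forall s : R, Rbar_lt s T -> is_derive A s (a s)).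
  { intros s hs; apply is_derive_RInt with t0; [| now apply ha].
    apply filter_imp with (2 := open_Rbar_lt' s T hs).
    intros b hb; apply RInt_correct, (ex_RInt_continuous (V := R_CompleteNormedModule)).
    intros v [_ hv]; apply ha.
    apply Rbar_le_lt_trans with (Rmax t0 b); [exact hv |].
    unfold Rmax; destruct Rle_dec; [exact hb | now apply hT]. }
  set (h := fun s => f s * exp (- A s)).
  set (h' := fun s => (f' s - a s * f s) * exp (- A s)).
  assert (hh : forall s : R, Rbar_lt s T -> is_derive h s (h' s)).
  { intros s hs; apply is_derive_integrating_factor; [now apply hf | now apply hA]. }
  destruct (MVT_gen h t0 t h') as [c [hc heq]].
  - intros s hs; apply hh, hT; rewrite Rmax_right in hs by lra; lra.
  - intros s hs; apply continuity_pt_filterlim.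
    eapply continuous_of_derive, hh, hT; rewrite Rmax_right in hs by lra; lra.
  - rewrite Rmax_right in hc by lra.
    assert (hc' : h' c <= 0).
    { unfold h'; pose proof (exp_pos (- A c)).
      specialize (hle c (hT c (proj2 hc))); nra. }
    assert (h t0 = f t0).
    { unfold h, A; rewrite RInt_point; unfold zero; simpl.
      rewrite Ropp_0, exp_0; ring. }
    assert (hneg : h t < 0) by nra.
    unfold h in hneg; pose proof (exp_pos (- A t)); nra.
Qed.

Lemma neg_from_minus_infinity (T : Rbar) (f f' a : R -> R) (l : R)
  (ha : forall s : R, Rbar_lt s T -> continuous a s)
  (hf : forall s : R, Rbar_lt s T -> is_derive f s (f' s))
  (hle : forall s : R, Rbar_lt s T -> f' s <= a s * f s)
  (hlim : is_lim f m_infty l) (hl : l < 0) (t : R) (htT : Rbar_lt t T) :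
  f t < 0.
Proof.
  apply is_lim_spec in hlim.
  destruct (hlim (mkposreal (- l) ltac:(lra))) as [m hm]; simpl in hm.
  pose proof (Rmin_l t (m - 1)); pose proof (Rmin_r t (m - 1)).
  apply neg_of_linear_inequality with T f' a (Rmin t (m - 1)); auto.
  specialize (hm (Rmin t (m - 1)) ltac:(lra)); apply Rabs_def2 in hm; lra.
Qed.

Lemma at_left_limit_of_bounded_derivative (f f' : R -> R) (a T M : R) (haT : a < T)
  (hf : forall s, a < s < T -> is_derive f s (f' s))
  (hM : forall s, a < s < T -> Rabs (f' s) <= M) :
  exists l : R, filterlim f (at_left T) (locally l).
Proof.
  assert (hM0 : 0 <= M).
  { eapply Rle_trans; [apply Rabs_pos | apply (hM ((a + T) / 2)); lra]. }
  apply (filterlim_locally_cauchy (U := R_CompleteSpace) (F := at_left T)).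
  intro eps.
  set (d := Rmin (T - a) (eps / (M + 1))).
  assert (hd : 0 < d).
  { apply Rmin_pos; [lra | apply Rdiv_lt_0_compat; [apply cond_pos | lra]]. }
  exists (fun s => T - d < s < T); split.
  - exists (mkposreal d hd); intros s hs hsT; simpl in hs.
    change (Rabs (s - T) < d) in hs; apply Rabs_def2 in hs; lra.
  - intros u v hu hv; change (Rabs (f v - f u) < eps).
    pose proof (Rmin_l (T - a) (eps / (M + 1))).
    pose proof (Rmin_r (T - a) (eps / (M + 1))); fold d in H, H0.
    destruct (MVT_gen f u v f') as [c [hc ->]].
    + intros s hs; apply hf; revert hs; unfold Rmin, Rmax; destruct Rle_dec; lra.
    + intros s hs; apply continuity_pt_filterlim.
      eapply continuous_of_derive, hf.
      revert hs; unfold Rmin, Rmax; destruct Rle_dec; lra.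
    + rewrite Rabs_mult.
      assert (hc' : Rabs (f' c) <= M).
      { apply hM; revert hc; unfold Rmin, Rmax; destruct Rle_dec; lra. }
      assert (huv : Rabs (v - u) < d) by (apply Rabs_def1; lra).
      apply Rle_lt_trans with (M * Rabs (v - u)).
      { apply Rmult_le_compat_r; [apply Rabs_pos | exact hc']. }
      apply Rle_lt_trans with (M * d).
      { apply Rmult_le_compat_l; lra. }
      apply Rle_lt_trans with (M * (eps / (M + 1))).
      { apply Rmult_le_compat_l; lra. }
      apply Rlt_le_trans with ((M + 1) * (eps / (M + 1))).
      { apply Rmult_lt_compat_r; lra. }
      right; field; lra.
Qed.

(** A function which is continuous at [t], and whose derivative near [t] is given
    off [t] by a function continuous at [t], is differentiable at [t] as well. *)
Lemma is_derive_of_punctured (f g : R -> R) (t d : R) (hd : 0 < d)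
  (hf : forall s, s <> t -> Rabs (s - t) < d -> is_derive f s (g s))
  (hft : continuous f t) (hgt : continuous g t) :
  is_derive f t (g t).
Proof.
  apply is_derive_Reals; intros eps heps.
  apply continuity_pt_filterlim in hgt.
  destruct (hgt eps heps) as [e [he hge]]; simpl in hge; unfold Rdist in hge.
  assert (hde : 0 < Rmin d e) by now apply Rmin_pos.
  exists (mkposreal _ hde); intros h hh0 hh; simpl in hh.
  pose proof (Rmin_l d e); pose proof (Rmin_r d e).
  destruct (MVT_gen f t (t + h) g) as [c [hc heq]].
  - intros s hs; apply hf; revert hs hh; unfold Rmin at 1, Rmax, Rabs;
      destruct Rle_dec; repeat destruct Rcase_abs; lra.
  - intros s hs; apply continuity_pt_filterlim.
    destruct (Req_dec s t) as [-> | hst]; [exact hft |].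
    eapply continuous_of_derive, hf; [exact hst |].
    revert hs hh; unfold Rmin at 1, Rmax, Rabs;
      destruct Rle_dec; repeat destruct Rcase_abs; lra.
  - rewrite heq.
    replace (g c * (t + h - t) / h - g t) with (g c - g t) by (field; exact hh0).
    destruct (Req_dec c t) as [-> | hct].
    + rewrite Rminus_diag, Rabs_R0; exact heps.
    + apply hge; repeat split; auto.
      revert hc hh; unfold Rmin at 1, Rmax, Rabs;
      destruct Rle_dec; repeat destruct Rcase_abs; lra.
Qed.

(** * Continuation of bounded Lotka-Volterra trajectories *)

(** The truncation of [v] to the interval from [- B] to [B]. *)
Definition clamp (B v : R) : R := Rmax (- B) (Rmin v B).

Lemma clamp_id B v : Rabs v <= B -> clamp B v = v.
Proof.
  unfold clamp, Rmax, Rmin, Rabs.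
  destruct Rcase_abs; repeat destruct Rle_dec; lra.
Qed.

Lemma clamp_bound B v : 0 <= B -> Rabs (clamp B v) <= B.
Proof.
  unfold clamp, Rmax, Rmin, Rabs; intro.
  destruct Rcase_abs; repeat destruct Rle_dec; lra.
Qed.

Lemma clamp_lipschitz B v w : Rabs (clamp B v - clamp B w) <= Rabs (v - w).
Proof.
  unfold clamp, Rmax, Rmin, Rabs.
  repeat destruct Rcase_abs; repeat destruct Rle_dec; lra.
Qed.

Lemma clamp_continuous B v : continuous (clamp B) v.
Proof.
  apply continuity_pt_filterlim; intros eps heps.
  exists eps; split; [exact heps |]; simpl; unfold Rdist.
  intros w [_ hw]; eapply Rle_lt_trans; [apply clamp_lipschitz | exact hw].
Qed.

(** Component [i] of the planar Lotka-Volterra field with growth rates [a i t] and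
    interaction coefficients [b i] (with itself) and [c i] (with the other
    component); a point of the plane is a function [bool -> R]. *)
Definition lotka_volterra (a : bool -> R -> R) (b c : bool -> R)
    (i : bool) (t : R) (z : bool -> R) : R :=
  z i * (a i t + b i * z i + c i * z (negb i)).

Lemma lotka_volterra_continuous a b c i (Z : bool -> R -> R) s
  (ha : forall j, continuous (a j) s) (hZ : forall j, continuous (Z j) s) :
  continuous (fun t => lotka_volterra a b c i t (fun j => Z j t)) s.
Proof.
  unfold lotka_volterra.
  apply (continuous_mult (K := R_AbsRing)); [apply hZ |].
  apply (continuous_plus (V := R_NormedModule)).
  - apply (continuous_plus (V := R_NormedModule)); [apply ha |].
    apply (continuous_mult (K := R_AbsRing)); [apply continuous_const | apply hZ].
  - apply (continuous_mult (K := R_AbsRing)); [apply continuous_const | apply hZ].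
Qed.

Lemma lotka_volterra_lipschitz a b c i s z z' N B D
  (ha : Rabs (a i s) <= N)
  (hz : forall j, Rabs (z j) <= B) (hz' : forall j, Rabs (z' j) <= B)
  (hD : forall j, Rabs (z j - z' j) <= D) :
  Rabs (lotka_volterra a b c i s z - lotka_volterra a b c i s z')
  <= (N + 2 * (Rabs (b i) + Rabs (c i)) * B) * D.
Proof.
  unfold lotka_volterra.
  assert (hB : 0 <= B) by (eapply Rle_trans; [apply Rabs_pos | apply (hz i)]).
  assert (hD0 : 0 <= D) by (eapply Rle_trans; [apply Rabs_pos | apply (hD i)]).
  assert (hm : forall u v U V, Rabs u <= U -> Rabs v <= V -> Rabs (u * v) <= U * V).
  { intros; rewrite Rabs_mult; apply Rmult_le_compat; auto using Rabs_pos. }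
  replace (_ - _) with
    ((z i - z' i) * (a i s + b i * z i + c i * z (negb i))
     + z' i * (b i * (z i - z' i) + c i * (z (negb i) - z' (negb i)))) by ring.
  replace ((N + 2 * (Rabs (b i) + Rabs (c i)) * B) * D)
    with (D * (N + Rabs (b i) * B + Rabs (c i) * B)
          + B * (Rabs (b i) * D + Rabs (c i) * D)) by ring.
  eapply Rle_trans; [apply Rabs_triang |].
  apply Rplus_le_compat; apply hm; auto.
  - eapply Rle_trans; [apply Rabs_triang |].
    apply Rplus_le_compat; [| apply hm; auto; lra].
    eapply Rle_trans; [apply Rabs_triang |].
    apply Rplus_le_compat; [auto | apply hm; auto; lra].
  - eapply Rle_trans; [apply Rabs_triang |].
    apply Rplus_le_compat; apply hm; auto; lra.
Qed.

Lemma bounded_near (f : R -> R) (t : R) (hf : forall s, continuous f s) :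
  exists N, forall s, Rabs (s - t) <= 1 -> Rabs (f s) <= N.
Proof.
  destruct (continuity_ab_maj (fun s => Rabs (f s)) (t - 1) (t + 1)) as [m [hm _]].
  - lra.
  - intros s _; apply continuity_pt_filterlim.
    apply (continuous_comp f Rabs); [apply hf | apply continuous_Rabs].
  - exists (Rabs (f m)); intros s hs; apply hm.
    revert hs; unfold Rabs; destruct Rcase_abs; lra.
Qed.

(** The field is only locally Lipschitz. The Picard-Lindelof theorem is applied to
    the field composed with a truncation at a level above the initial values; near
    [t0] the solution does not reach that level. *)
Lemma lotka_volterra_local (a : bool -> R -> R) (b c : bool -> R)
  (t0 : R) (z0 : bool -> R) (ha : forall i s, continuous (a i) s) :
  exists d, 0 < d /\ exists Z : bool -> R -> R,
    (forall i, Z i t0 = z0 i) /\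
    (forall i t, Rabs (t - t0) < d ->
       is_derive (Z i) t (lotka_volterra a b c i t (fun j => Z j t))).
Proof.
  set (B := 1 + Rabs (z0 true) + Rabs (z0 false)).
  assert (hz0 : forall i, Rabs (z0 i) + 1 <= B).
  { unfold B; pose proof (Rabs_pos (z0 true)); pose proof (Rabs_pos (z0 false)).
    intros [|]; lra. }
  assert (hB : 0 <= B).
  { specialize (hz0 true); pose proof (Rabs_pos (z0 true)); lra. }
  assert (hN : exists N, forall i s, Rabs (s - t0) <= 1 -> Rabs (a i s) <= N).
  { destruct (bounded_near (a true) t0 (ha true)) as [N1 h1].
    destruct (bounded_near (a false) t0 (ha false)) as [N2 h2].
    exists (Rmax N1 N2); intros [|] s hs.
    - eapply Rle_trans; [now apply h1 | apply Rmax_l].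
    - eapply Rle_trans; [now apply h2 | apply Rmax_r]. }
  destruct hN as [N hN].
  set (C := Rabs (b true) + Rabs (c true) + Rabs (b false) + Rabs (c false)).
  assert (hC : forall i, 0 <= Rabs (b i) + Rabs (c i) <= C).
  { pose proof (fun i => Rabs_pos (b i)) as h1; pose proof (fun i => Rabs_pos (c i)) as h2.
    pose proof (h1 true); pose proof (h1 false); pose proof (h2 true);
      pose proof (h2 false); unfold C; intros [|]; lra. }
  assert (hN0 : 0 <= N).
  { eapply Rle_trans; [apply Rabs_pos | apply (hN true t0)].
    rewrite Rminus_diag, Rabs_R0; lra. }
  destruct (picard_lindelof bool
              (fun i s z => lotka_volterra a b c i s (fun j => clamp B (z j)))
              t0 z0 (N + 2 * C * B) ((N + 2 * C * B) * B)) as [d [hd [Z [hZ0 hZ]]]].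
  - intros i Z s hZ.
    apply (lotka_volterra_continuous a b c i (fun j t => clamp B (Z j t))).
    + intro j; apply ha.
    + intro j; apply (continuous_comp (Z j) (clamp B)); [apply hZ | apply clamp_continuous].
  - intros i s z z' D hs hD.
    assert (hD0 : 0 <= D) by (eapply Rle_trans; [apply Rabs_pos | apply (hD true)]).
    eapply Rle_trans.
    + apply lotka_volterra_lipschitz with (N := N) (B := B) (D := D); auto.
      * intro j; now apply clamp_bound.
      * intro j; now apply clamp_bound.
      * intro j; eapply Rle_trans; [apply clamp_lipschitz | apply hD].
    + apply Rmult_le_compat_r; [exact hD0 |].
      apply Rplus_le_compat_l, Rmult_le_compat_r; [exact hB |].
      specialize (hC i); lra.
  - intros i s hs.
    (* the field vanishes at the origin, so the Lipschitz estimate bounds it *)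
    replace (lotka_volterra a b c i s (fun j => clamp B (z0 j)))
      with (lotka_volterra a b c i s (fun j => clamp B (z0 j))
            - lotka_volterra a b c i s (fun j => 0))
      by (unfold lotka_volterra; ring).
    eapply Rle_trans.
    + apply lotka_volterra_lipschitz with (N := N) (B := B) (D := B); auto.
      * intro j; now apply clamp_bound.
      * intro j; now rewrite Rabs_R0.
      * intro j; rewrite Rminus_0_r; now apply clamp_bound.
    + apply Rmult_le_compat_r; [exact hB |].
      apply Rplus_le_compat_l, Rmult_le_compat_r; [exact hB |].
      specialize (hC i); lra.
  - pose proof (hC true); nra.
  - assert (hin : forall i, exists e, 0 < e /\
              forall t, Rabs (t - t0) < e -> Rabs (Z i t) <= B).
    { intro i.
      assert (hc : continuous (Z i) t0).
      { eapply continuous_of_derive, hZ.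
        rewrite Rminus_diag, Rabs_R0; exact hd. }
      pose proof (proj1 (filterlim_locally (U := R_UniformSpace) _ _) hc) as hc'.
      destruct (hc' (mkposreal 1 Rlt_0_1)) as [e he]; rewrite hZ0 in he.
      exists e; split; [apply cond_pos |]; intros t ht.
      specialize (he t ht); change (Rabs (Z i t - z0 i) < 1) in he.
      specialize (hz0 i).
      replace (Z i t) with ((Z i t - z0 i) + z0 i) by ring.
      eapply Rle_trans; [apply Rabs_triang | lra]. }
    destruct (hin true) as [e1 [he1 hin1]]; destruct (hin false) as [e2 [he2 hin2]].
    exists (Rmin d (Rmin e1 e2)); split.
    { repeat apply Rmin_pos; assumption. }
    exists Z; split; [exact hZ0 |]; intros i t ht.
    pose proof (Rmin_l d (Rmin e1 e2)); pose proof (Rmin_r d (Rmin e1 e2)).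
    pose proof (Rmin_l e1 e2); pose proof (Rmin_r e1 e2).
    assert (hcl : forall j, clamp B (Z j t) = Z j t).
    { intros [|]; apply clamp_id; [apply hin1 | apply hin2]; lra. }
    replace (lotka_volterra a b c i t (fun j => Z j t))
      with (lotka_volterra a b c i t (fun j => clamp B (Z j t))).
    + apply hZ; lra.
    + unfold lotka_volterra; now rewrite !hcl.
Qed.

(** The function equal to [f] before [T] and to [g] from [T] on. *)
Definition glue (T : R) (f g : R -> R) (t : R) : R :=
  if Rlt_dec t T then f t else g t.

Lemma glue_left T f g t : t < T -> glue T f g t = f t.
Proof. unfold glue; destruct Rlt_dec; lra. Qed.

Lemma glue_right T f g t : T <= t -> glue T f g t = g t.
Proof. unfold glue; destruct Rlt_dec; lra. Qed.

Lemma glue_continuous T f g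
  (hf : filterlim f (at_left T) (locally (g T))) (hg : continuous g T) :
  continuous (glue T f g) T.
Proof.
  intros P hP; rewrite glue_right in hP by lra.
  destruct (hf P hP) as [d1 h1]; destruct (hg P hP) as [d2 h2].
  assert (hd : 0 < Rmin d1 d2) by (apply Rmin_pos; apply cond_pos).
  exists (mkposreal _ hd); intros s hs.
  change (Rabs (s - T) < Rmin d1 d2) in hs.
  pose proof (Rmin_l d1 d2); pose proof (Rmin_r d1 d2).
  unfold glue; destruct Rlt_dec as [hsT | hsT].
  - apply h1; [change (Rabs (s - T) < d1); lra | exact hsT].
  - apply h2; change (Rabs (s - T) < d2); lra.
Qed.

(** A solution that stays bounded up to a finite time [T] can be prolonged. *)
Lemma lotka_volterra_continue (a : bool -> R -> R) (b c : bool -> R)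
  (Z : bool -> R -> R) (T t1 B : R)
  (ha : forall i s, continuous (a i) s)
  (hZ : forall i t, t < T ->
          is_derive (Z i) t (lotka_volterra a b c i t (fun j => Z j t)))
  (ht1 : t1 < T) (hB : forall i t, t1 < t < T -> Rabs (Z i t) <= B) :
  exists d, 0 < d /\ exists W : bool -> R -> R,
    (forall i t, t < T -> W i t = Z i t) /\
    (forall i t, t < T + d ->
       is_derive (W i) t (lotka_volterra a b c i t (fun j => W j t))).
Proof.
  assert (hB0 : 0 <= B).
  { eapply Rle_trans; [apply Rabs_pos | apply (hB true ((t1 + T) / 2)); lra]. }
  assert (hlim : forall i, exists l : R, filterlim (Z i) (at_left T) (locally l)).
  { intro i; destruct (bounded_near (a i) T (ha i)) as [N hN].
    pose proof (Rmax_l t1 (T - 1)); pose proof (Rmax_r t1 (T - 1)).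
    apply at_left_limit_of_bounded_derivative with
      (fun t => lotka_volterra a b c i t (fun j => Z j t)) (Rmax t1 (T - 1))
      ((N + 2 * (Rabs (b i) + Rabs (c i)) * B) * B).
    - apply Rmax_lub_lt; lra.
    - intros s hs; apply hZ; lra.
    - intros s hs.
      replace (lotka_volterra a b c i s (fun j => Z j s))
        with (lotka_volterra a b c i s (fun j => Z j s)
              - lotka_volterra a b c i s (fun j => 0))
        by (unfold lotka_volterra; ring).
      apply lotka_volterra_lipschitz.
      + apply hN, Rabs_le; lra.
      + intro j; apply hB; lra.
      + intro j; now rewrite Rabs_R0.
      + intro j; rewrite Rminus_0_r; apply hB; lra. }
  destruct (hlim true) as [l1 hl1]; destruct (hlim false) as [l2 hl2].
  destruct (lotka_volterra_local a b c T (fun i => if i then l1 else l2) ha)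
    as [d [hd [Y [hY0 hY]]]].
  assert (hYT : forall i, is_derive (Y i) T (lotka_volterra a b c i T (fun j => Y j T))).
  { intro i; apply hY; rewrite Rminus_diag, Rabs_R0; exact hd. }
  set (W := fun i => glue T (Z i) (Y i)).
  assert (hoff : forall i t, t <> T -> t < T + d ->
       is_derive (W i) t (lotka_volterra a b c i t (fun j => W j t))).
  { intros i t htT ht; unfold W, lotka_volterra.
    destruct (Rlt_dec t T) as [hlt | hge].
    - rewrite !glue_left by exact hlt.
      apply is_derive_ext_loc with (Z i); [| now apply hZ].
      apply filter_imp with (2 := open_lt T t hlt).
      intros s hs; now rewrite glue_left.
    - assert (hgt : T < t) by lra.
      rewrite !glue_right by lra.
      apply is_derive_ext_loc with (Y i); [| apply hY, Rabs_def1; lra].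
      apply filter_imp with (2 := open_gt T t hgt).
      intros s hs; rewrite glue_right by lra; reflexivity. }
  assert (hWT : forall i, continuous (W i) T).
  { intro i; apply glue_continuous.
    - rewrite hY0; destruct i; assumption.
    - eapply continuous_of_derive, hYT. }
  exists d; split; [exact hd |]; exists W; split.
  - intros i t ht; now apply glue_left.
  - intros i t ht; destruct (Req_dec t T) as [-> | hne]; [| now apply hoff].
    apply (is_derive_of_punctured (W i)
             (fun s => lotka_volterra a b c i s (fun j => W j s)) T d hd).
    + intros s hs hsd; apply hoff; [exact hs |].
      apply Rabs_def2 in hsd; lra.
    + apply hWT.
    + apply lotka_volterra_continuous; auto.
Qed.

(** * The weight near the origin *)

Lemma C2_pos_derive (f : R -> R) (hf : C2_pos f) (r : R) (hr : 0 < r) :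
  is_derive f r (Derive f r).
Proof. apply Derive_correct, (hf r hr 1%nat); lia. Qed.

Lemma C2_pos_continuous_Derive (f : R -> R) (hf : C2_pos f) (r : R) (hr : 0 < r) :
  continuous (Derive f) r.
Proof. exact (proj2 (hf r hr 1%nat ltac:(lia))). Qed.

Lemma nu_continuous (n : nat) (rho : R -> R) (h2 : C2_pos rho)
  (hpos : forall r, 0 < r -> 0 < rho r) (t : R) : continuous (nu n rho) t.
Proof.
  apply continuity_pt_filterlim.
  assert (he : continuity_pt exp t) by apply derivable_continuous_pt, derivable_pt_exp.
  assert (hd : continuity_pt (fun t => Derive rho (exp t)) t).
  { apply (continuity_pt_comp exp); [exact he |].
    apply continuity_pt_filterlim, C2_pos_continuous_Derive; [exact h2 | apply exp_pos]. }
  assert (hr : continuity_pt (fun t => rho (exp t)) t).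
  { apply (continuity_pt_comp exp); [exact he |].
    apply continuity_pt_filterlim.
    eapply continuous_of_derive, C2_pos_derive; [exact h2 | apply exp_pos]. }
  unfold nu, rho_R.
  apply (continuity_pt_plus (fun _ => INR n)).
  - now apply continuity_pt_const.
  - apply (continuity_pt_div (fun t => exp t * Derive rho (exp t)) (fun t => rho (exp t))).
    + now apply (continuity_pt_mult exp).
    + exact hr.
    + apply Rgt_not_eq, hpos, exp_pos.
Qed.

Lemma rho_K_derive (rho : R -> R) (l0 r : R) (h2 : C2_pos rho)
  (hr : 0 < r) (hpos : 0 < rho r) :
  is_derive (rho_K rho l0) r (rho_K rho l0 r * ((rho_R rho r - l0) / r)).
Proof.
  pose proof (C2_pos_derive rho h2 r hr) as hd.
  unfold rho_K, rho_R, Rpower.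
  auto_derive.
  - repeat split; [exact hr | now exists (Derive rho r)].
  - change (Derive (fun x => rho x) r) with (Derive rho r); field; lra.
Qed.

(** The logarithmic derivative of [rho_K rho l0] is [(rho_R rho r - l0) / r <= 0]. *)
Lemma rho_K_antitone (rho : R -> R) (l0 : R) (h2 : C2_pos rho)
  (hpos : forall r, 0 < r -> 0 < rho r)
  (hR : forall r, 0 < r -> rho_R rho r <= l0) (r s : R) :
  0 < r -> r <= s -> rho_K rho l0 s <= rho_K rho l0 r.
Proof.
  intros hr hrs.
  destruct (MVT_gen (rho_K rho l0) r s
              (fun r => rho_K rho l0 r * ((rho_R rho r - l0) / r))) as [c [hc heq]].
  - rewrite Rmin_left, Rmax_right by lra.
    intros v hv; apply rho_K_derive; [exact h2 | lra | apply hpos; lra].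
  - rewrite Rmin_left, Rmax_right by lra.
    intros v hv; apply continuity_pt_filterlim.
    eapply continuous_of_derive, rho_K_derive; [exact h2 | lra | apply hpos; lra].
  - rewrite Rmin_left, Rmax_right in hc by lra.
    assert (hc0 : 0 < c) by lra.
    assert (hK : 0 < rho_K rho l0 c) by (apply Rmult_lt_0_compat; [apply exp_pos | auto]).
    assert (h1 : (rho_R rho c - l0) / c <= 0).
    { specialize (hR c hc0); apply Rmult_le_reg_r with c; [exact hc0 |].
      unfold Rdiv; rewrite Rmult_assoc, Rinv_l; lra. }
    assert (rho_K rho l0 c * ((rho_R rho c - l0) / c) <= 0) by nra.
    nra.
Qed.

Lemma at_right_0_of_interval (d : R) (P : R -> Prop) (hd : 0 < d) :
  (forall r, 0 < r < d -> P r) -> at_right 0 P.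
Proof.
  intro hP; exists (mkposreal d hd); intros r hr hr0; apply hP; split; [exact hr0 |].
  change (Rabs (r - 0) < d) in hr; rewrite Rminus_0_r in hr.
  eapply Rle_lt_trans; [apply Rle_abs | exact hr].
Qed.

Lemma antitone_bounded_limit (f : R -> R) (L : R)
  (hf : forall r s, 0 < r -> r <= s -> f s <= f r)
  (hpos : forall r, 0 < r -> 0 < f r < L) :
  exists l : R, filterlim f (at_right 0) (locally l) /\ 0 < l.
Proof.
  destruct (completeness (fun v => exists r, 0 < r /\ v = f r)) as [l [hub hlub]].
  - exists L; intros v [r [hr ->]]; apply Rlt_le, hpos, hr.
  - exists (f 1), 1; split; [lra | reflexivity].
  - exists l; split.
    + apply (filterlim_locally (U := R_UniformSpace)); intro eps.
      destruct (Classical_Prop.classic (exists r, 0 < r /\ l - eps < f r))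
        as [[r [hr hlr]] | hno].
      * apply at_right_0_of_interval with r; [exact hr |].
        intros s hs; change (Rabs (f s - l) < eps).
        assert (f s <= l) by (apply hub; exists s; split; [lra | reflexivity]).
        assert (f r <= f s) by (apply hf; lra).
        pose proof (cond_pos eps); apply Rabs_def1; lra.
      * exfalso; assert (l <= l - eps); [| pose proof (cond_pos eps); lra].
        apply hlub; intros v [r [hr ->]].
        apply Rnot_lt_le; intro; apply hno; now exists r.
    + apply Rlt_le_trans with (f 1); [apply hpos; lra |].
      apply hub; exists 1; split; [lra | reflexivity].
Qed.

(** If [l0] were negative, then [rho r = r^l0 * K r >= r^l0 * K 1] for [r <= 1]
    would be unbounded near [0], against continuity there. *)
Lemma l0_nonneg (rho : R -> R) (l0 : R) (h2 : C2_pos rho)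
  (hc : continuous_on (fun r => 0 <= r) rho)
  (hpos : forall r, 0 < r -> 0 < rho r)
  (hR : forall r, 0 < r -> rho_R rho r <= l0) : 0 <= l0.
Proof.
  apply Rnot_lt_le; intro hl.
  destruct (proj1 (filterlim_locally (U := R_UniformSpace) _ _) (hc 0 (Rle_refl 0))
              (mkposreal 1 Rlt_0_1)) as [d hd].
  set (K1 := rho_K rho l0 1); set (M := Rabs (rho 0) + 1).
  assert (hK1 : 0 < K1) by (apply Rmult_lt_0_compat; [apply exp_pos | apply hpos; lra]).
  assert (hM : 0 < M) by (unfold M; pose proof (Rabs_pos (rho 0)); lra).
  (* the point [r = exp s] lies in the neighbourhood of size [d], is at most [1],
     and satisfies [r^l0 = exp (l0 * s) > M / K1] *)
  set (s := Rmin (Rmin (ln d - 1) 0) (M / (K1 * l0))).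
  assert (hs1 : s <= ln d - 1).
  { eapply Rle_trans; apply Rmin_l. }
  assert (hs2 : s <= 0).
  { eapply Rle_trans; [apply Rmin_l | apply Rmin_r]. }
  assert (hs3 : s <= M / (K1 * l0)) by apply Rmin_r.
  set (r := exp s).
  assert (hr : 0 < r) by apply exp_pos.
  assert (hrd : r < d).
  { unfold r; rewrite <- (exp_ln d) by apply cond_pos; apply exp_increasing; lra. }
  assert (hr1 : r <= 1).
  { unfold r; rewrite <- exp_0; destruct (Rle_lt_or_eq_dec s 0 hs2) as [h | h].
    - apply Rlt_le; now apply exp_increasing.
    - rewrite h; lra. }
  specialize (hd r).
  assert (hlt : rho r < M).
  { assert (hb : Rabs (rho r - rho 0) < 1).
    { apply hd; [| lra].
      change (Rabs (r - 0) < d); rewrite Rminus_0_r, Rabs_pos_eq; lra. }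
    apply Rabs_def2 in hb; pose proof (Rle_abs (rho 0)); unfold M; lra. }
  assert (hK : K1 <= rho_K rho l0 r) by (apply rho_K_antitone; auto).
  assert (hrho : rho r = exp (l0 * s) * rho_K rho l0 r).
  { unfold rho_K, Rpower, r; rewrite ln_exp, <- Rmult_assoc, <- exp_plus.
    replace (l0 * s + - l0 * s) with 0 by ring; rewrite exp_0; ring. }
  pose proof (exp_ineq1_le (l0 * s)) as hexp.
  assert (hls : M / K1 <= l0 * s).
  { replace (M / K1) with (l0 * (M / (K1 * l0))) by (field; lra).
    apply Rmult_le_compat_neg_l; lra. }
  assert (M <= rho r); [| lra].
  rewrite hrho; replace M with (M / K1 * K1) by (field; lra).
  assert (0 < M / K1) by now apply Rdiv_lt_0_compat.
  apply Rmult_le_compat; lra.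
Qed.

(** * Positivity, boundedness and global existence of the trajectory *)

(** A solution of the planar system on the half-line up to [T] that emanates from
    the point [(x_hat, y_hat)], in the supercritical range. *)
Section Trajectory.
Variables (n k : nat) (q : R) (rho : R -> R) (l0 : R) (x y : R -> R) (T : Rbar).
Hypotheses (hk : (0 < k)%nat) (hn : (2 * k < n)%nat) (hq : INR k < q).
Hypothesis rho_C2 : C2_pos rho.
Hypothesis rho_pos : forall r, 0 < r -> 0 < rho r.
Hypothesis hR : forall r, 0 < r -> rho_R rho r <= l0.
Hypothesis hl0 : 0 <= l0.
Hypothesis hqs : q_star n k l0 <= q.
Hypothesis hsol : solves_system n k q rho x y T.
Hypothesis hx : is_lim x m_infty (x_hat n k q l0).
Hypothesis hy : is_lim y m_infty (y_hat k q l0).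

Lemma INR_facts : 0 < INR k /\ 0 < INR n - 2 * INR k.
Proof.
  split; [now apply lt_0_INR |].
  apply lt_INR in hn; rewrite mult_INR in hn; simpl in hn; lra.
Qed.

(** The condition [q_star n k l0 <= q] without denominators. *)
Lemma supercritical : (INR k + 1) * (INR n + l0) <= (q + 1) * (INR n - 2 * INR k).
Proof.
  destruct INR_facts as [h1 h2].
  unfold q_star in hqs.
  apply (Rmult_le_compat_r (INR n - 2 * INR k)) in hqs; [| lra].
  unfold Rdiv in hqs; rewrite Rmult_assoc, Rinv_l in hqs by lra; lra.
Qed.

Lemma x_hat_pos : 0 < x_hat n k q l0.
Proof.
  destruct INR_facts as [h1 h2]; pose proof supercritical.
  apply Rdiv_lt_0_compat; [| lra]; nra.
Qed.

Lemma y_hat_pos : 0 < y_hat k q l0.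
Proof.
  destruct INR_facts as [h1 h2].
  apply Rdiv_lt_0_compat; lra.
Qed.

Lemma x_continuous (t : R) : Rbar_lt t T -> continuous x t.
Proof. intro ht; eapply continuous_of_derive, (proj1 (hsol t ht)). Qed.

Lemma y_continuous (t : R) : Rbar_lt t T -> continuous y t.
Proof. intro ht; eapply continuous_of_derive, (proj2 (hsol t ht)). Qed.

Lemma x_pos (t : R) : Rbar_lt t T -> 0 < x t.
Proof.
  intro ht.
  cut (- x t < 0); [lra |].
  apply (neg_from_minus_infinity T (fun t => - x t)
           (fun t => - (x t * (nu n rho t - x t - q * y t)))
           (fun t => nu n rho t - x t - q * y t) (- x_hat n k q l0)).
  - intros s hs.
    apply (continuous_minus (V := R_NormedModule)).
    + apply (continuous_minus (V := R_NormedModule)).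
      * now apply nu_continuous.
      * now apply x_continuous.
    + apply (continuous_scal_r (V := R_NormedModule) q y); now apply y_continuous.
  - intros s hs; apply (is_derive_opp (V := R_NormedModule)), (hsol s hs).
  - intros s hs; lra.
  - exact (is_lim_opp x m_infty _ hx).
  - pose proof x_hat_pos; lra.
  - exact ht.
Qed.

Lemma y_pos (t : R) : Rbar_lt t T -> 0 < y t.
Proof.
  intro ht.
  cut (- y t < 0); [lra |].
  apply (neg_from_minus_infinity T (fun t => - y t)
           (fun t => - (y t * (- ((INR n - 2 * INR k) / INR k) + x t / INR k + y t)))
           (fun t => - ((INR n - 2 * INR k) / INR k) + x t / INR k + y t)
           (- y_hat k q l0)).
  - intros s hs.
    apply (continuous_plus (V := R_NormedModule)).
    + apply (continuous_plus (V := R_NormedModule)).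
      * apply continuous_const.
      * apply (continuous_ext (fun t => / INR k * x t)).
        { intro; apply Rmult_comm. }
        apply (continuous_scal_r (V := R_NormedModule) (/ INR k) x); now apply x_continuous.
    + now apply y_continuous.
  - intros s hs; apply (is_derive_opp (V := R_NormedModule)), (hsol s hs).
  - intros s hs; lra.
  - exact (is_lim_opp y m_infty _ hy).
  - pose proof y_hat_pos; lra.
  - exact ht.
Qed.

(** Negativity of [G], the Pohozaev function divided by its positive weight. *)
Lemma pohozaev_neg (t : R) : Rbar_lt t T ->
  INR k / (INR k + 1) * y t + / (q + 1) * x t
    + (- ((INR n - 2 * INR k) / (INR k + 1))) < 0.
Proof.
  destruct INR_facts as [h1 h2]; intro ht.
  set (al := INR k / (INR k + 1)); set (be := / (q + 1)).
  set (b := (INR n - 2 * INR k) / (INR k + 1)).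
  apply (neg_from_minus_infinity T (fun t => al * y t + be * x t + - b)
           (fun t => al * (y t * (- ((INR n - 2 * INR k) / INR k) + x t / INR k + y t))
                     + be * (x t * (nu n rho t - x t - q * y t)) + 0)
           (fun t => y t - x t)
           (al * y_hat k q l0 + be * x_hat n k q l0 + - b)).
  - intros s hs; apply (continuous_minus (V := R_NormedModule)).
    + now apply y_continuous.
    + now apply x_continuous.
  - intros s hs; destruct (hsol s hs) as [hxs hys].
    apply (is_derive_plus (V := R_NormedModule) (fun t => al * y t + be * x t)).
    + apply (is_derive_plus (V := R_NormedModule) (fun t => al * y t)).
      * now apply (is_derive_scal y).
      * now apply (is_derive_scal x).
    + exact (is_derive_const (K := R_AbsRing) (V := R_NormedModule) (- b) s).
  - intros s hs.
    (* by supercriticality the source term [x (nu / (q+1) - b)] of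
       the equation for [G] is nonpositive *)
    assert (hnu : nu n rho s * be <= b).
    { apply Rle_trans with ((INR n + l0) * be).
      - apply Rmult_le_compat_r; [apply Rlt_le, Rinv_0_lt_compat; lra |].
        unfold nu; pose proof (hR (exp s) (exp_pos s)); lra.
      - unfold b, be.
        apply Rmult_le_reg_r with ((q + 1) * (INR k + 1)); [nra |].
        replace ((INR n + l0) * / (q + 1) * ((q + 1) * (INR k + 1)))
          with ((INR k + 1) * (INR n + l0)) by (field; lra).
        replace ((INR n - 2 * INR k) / (INR k + 1) * ((q + 1) * (INR k + 1)))
          with ((q + 1) * (INR n - 2 * INR k)) by (field; lra).
        exact supercritical. }
    pose proof (x_pos s hs) as hxs.
    assert (0 <= x s * (b - nu n rho s * be)) by (apply Rmult_le_pos; lra).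
    apply Rle_trans with
      ((y s - x s) * (al * y s + be * x s + - b) - x s * (b - nu n rho s * be)); [| lra].
    right; unfold al, be, b; field; lra.
  - apply (is_lim_plus' (fun t => al * y t + be * x t)); [| apply is_lim_const].
    apply (is_lim_plus' (fun t => al * y t)).
    + exact (is_lim_scal_l y al m_infty _ hy).
    + exact (is_lim_scal_l x be m_infty _ hx).
  - replace (al * y_hat k q l0 + be * x_hat n k q l0 + - b)
      with (- ((q - INR k) / ((INR k + 1) * (q + 1)) * x_hat n k q l0))
      by (unfold al, be, b, x_hat, y_hat; field; lra).
    pose proof x_hat_pos.
    apply Ropp_lt_gt_0_contravar, Rmult_lt_0_compat; [| lra].
    apply Rdiv_lt_0_compat; [lra | nra].
  - exact ht.
Qed.

Lemma trajectory_bounded (t : R) : Rbar_lt t T ->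
  x t < (q + 1) * (INR n - 2 * INR k) /\ y t < (INR n - 2 * INR k) / INR k.
Proof.
  intro ht; destruct INR_facts as [h1 h2].
  pose proof (pohozaev_neg t ht) as hG.
  pose proof (x_pos t ht) as hxt; pose proof (y_pos t ht) as hyt.
  assert (hG' : (q + 1) * INR k * y t + (INR k + 1) * x t
                < (q + 1) * (INR n - 2 * INR k)).
  { apply (Rmult_lt_compat_r ((q + 1) * (INR k + 1))) in hG; [| nra].
    rewrite Rmult_0_l in hG.
    replace (_ * ((q + 1) * (INR k + 1))) with
      ((q + 1) * INR k * y t + (INR k + 1) * x t - (q + 1) * (INR n - 2 * INR k)) in hG
      by (field; lra).
    lra. }
  assert (0 < (q + 1) * INR k * y t) by (repeat apply Rmult_lt_0_compat; lra).
  assert (0 < INR k * x t) by (apply Rmult_lt_0_compat; lra).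
  split; [lra |].
  apply Rmult_lt_reg_l with ((q + 1) * INR k); [nra |].
  replace ((q + 1) * INR k * ((INR n - 2 * INR k) / INR k))
    with ((q + 1) * (INR n - 2 * INR k)) by (field; lra).
  lra.
Qed.
End Trajectory.

Lemma trajectory_global (n k : nat) (q : R) (rho : R -> R) (l0 : R) (x y : R -> R)
  (T : Rbar) (hk : (0 < k)%nat) (hn : (2 * k < n)%nat) (hq : INR k < q)
  (rho_C2 : C2_pos rho) (rho_pos : forall r, 0 < r -> 0 < rho r)
  (hR : forall r, 0 < r -> rho_R rho r <= l0) (hl0 : 0 <= l0)
  (hqs : q_star n k l0 <= q)
  (hxy : maximal_trajectory n k q rho x y T)
  (hx : is_lim x m_infty (x_hat n k q l0))
  (hy : is_lim y m_infty (y_hat k q l0)) : T = p_infty.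
Proof.
  destruct hxy as [hT [hsol hmax]].
  destruct T as [T | |]; [exfalso | reflexivity | contradiction].
  destruct (INR_facts n k hk hn) as [h1 h2].
  set (a := fun (i : bool) t => if i then nu n rho t else - ((INR n - 2 * INR k) / INR k)).
  set (b := fun i : bool => if i then - 1 else 1).
  set (c := fun i : bool => if i then - q else / INR k).
  set (Z := fun i : bool => if i then x else y).
  assert (hbound : forall t, t < T -> 0 < x t < (q + 1) * (INR n - 2 * INR k)
             /\ 0 < y t < (INR n - 2 * INR k) / INR k).
  { intros t ht.
    assert (x t < (q + 1) * (INR n - 2 * INR k) /\ y t < (INR n - 2 * INR k) / INR k)
      by (eapply trajectory_bounded; eassumption).
    assert (0 < x t) by (eapply x_pos; eassumption).
    assert (0 < y t) by (eapply y_pos; eassumption).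
    lra. }
  destruct (lotka_volterra_continue a b c Z T (T - 1)
              ((q + 1) * (INR n - 2 * INR k) + (INR n - 2 * INR k) / INR k))
    as [d [hd [W [hWZ hW]]]].
  - intros [|] s; [now apply nu_continuous | apply continuous_const].
  - intros [|] t ht; destruct (hsol t ht) as [hxt hyt];
      unfold lotka_volterra, a, b, c, Z; simpl.
    + replace (x t * _) with (x t * (nu n rho t - x t - q * y t)) by ring; exact hxt.
    + replace (y t * _) with
        (y t * (- ((INR n - 2 * INR k) / INR k) + x t / INR k + y t))
        by (unfold Rdiv; ring); exact hyt.
  - lra.
  - intros i t [_ ht]; destruct (hbound t ht) as [hb1 hb2].
    destruct i; simpl; rewrite Rabs_pos_eq; lra.
  - apply (hmax (T + d) (W true) (W false)).
    + simpl; lra.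
    + intros t ht; split.
      * replace (_ * _) with (lotka_volterra a b c true t (fun j => W j t))
          by (unfold lotka_volterra, a, b, c; simpl; ring).
        now apply hW.
      * replace (_ * _) with (lotka_volterra a b c false t (fun j => W j t))
          by (unfold lotka_volterra, a, b, c, Rdiv; simpl; ring).
        now apply hW.
    + intros t ht; split; [exact (hWZ true t ht) | exact (hWZ false t ht)].
Qed.

(** * The solution of the boundary value problem *)

Lemma pow_exp (v : R) (m : nat) : exp v ^ m = exp (INR m * v).
Proof.
  rewrite <- Rpower_pow by apply exp_pos; unfold Rpower; now rewrite ln_exp.
Qed.

Lemma c_nk_pos (n k : nat) (hn : (0 < n)%nat) : 0 < c_nk n k.
Proof.
  apply Rdiv_lt_0_compat; [| now apply lt_0_INR].
  apply Rdiv_lt_0_compat; [| apply Rmult_lt_0_compat]; apply INR_fact_lt_0.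
Qed.

(** The function [u = 1 - w] built from a positive solution of the planar system on
    the whole line. Everything is written through logarithms, so that powers become
    linear expressions. *)
Section Solution.
Variables (n k : nat) (q : R) (rho x y : R -> R) (lam : R).
Hypotheses (hk : (0 < k)%nat) (hn : (2 * k < n)%nat) (hq : INR k < q).
Hypothesis rho_C2 : C2_pos rho.
Hypothesis rho_pos : forall r, 0 < r -> 0 < rho r.
Hypothesis hsol : solves_system n k q rho x y p_infty.
Hypothesis hxp : forall t, 0 < x t.
Hypothesis hyp : forall t, 0 < y t.
Hypothesis hlam : 0 < lam.

(** The logarithm of [w = (c x y^k / (lambda r^(2k) rho))^(1/(q-k))]. *)
Definition log_w (r : R) : R :=
  1 / (q - INR k) * (ln (c_nk n k) - ln lam + ln (x (ln r)) + INR k * ln (y (ln r))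
                     - 2 * INR k * ln r - ln (rho r)).

(** The solution [u = 1 - w]. *)
Definition sol (r : R) : R := 1 - exp (log_w r).

(** The logarithm of [r^(n-2k) (w y)^k], the flux of [sol]. *)
Definition log_flux (r : R) : R :=
  (INR n - 2 * INR k) * ln r + INR k * log_w r + INR k * ln (y (ln r)).

(** The chain rule for [ln (z (ln r))], given the logarithmic derivative [l] of
    [z]. *)
Lemma is_derive_log_along (z : R -> R) (l r : R) (hr : 0 < r) (hz : 0 < z (ln r))
  (hd : is_derive z (ln r) (z (ln r) * l)) :
  is_derive (fun r => ln (z (ln r))) r (l / r).
Proof.
  replace (l / r) with (/ r * (z (ln r) * l) * / z (ln r)) by (field; lra).
  rewrite Rmult_comm.
  evar_last.
  - apply (is_derive_comp ln (fun r => z (ln r))).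
    + now apply is_derive_ln.
    + apply (is_derive_comp z ln); [exact hd | now apply is_derive_ln].
  - unfold scal; simpl; unfold mult; simpl; ring.
Qed.

Lemma log_x_derive r : 0 < r ->
  is_derive (fun r => ln (x (ln r))) r
    ((nu n rho (ln r) - x (ln r) - q * y (ln r)) / r).
Proof. intro hr; apply is_derive_log_along; auto; apply (hsol (ln r) I). Qed.

Lemma log_y_derive r : 0 < r ->
  is_derive (fun r => ln (y (ln r))) r
    ((- ((INR n - 2 * INR k) / INR k) + x (ln r) / INR k + y (ln r)) / r).
Proof. intro hr; apply is_derive_log_along; auto; apply (hsol (ln r) I). Qed.

Lemma log_w_derive r : 0 < r -> is_derive log_w r (- (y (ln r) / r)).
Proof.
  intro hr; destruct (INR_facts n k hk hn) as [h1 h2].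
  pose proof (log_x_derive r hr) as hX; pose proof (log_y_derive r hr) as hY.
  pose proof (C2_pos_derive rho rho_C2 r hr) as hrho.
  pose proof (rho_pos r hr) as hp.
  set (X := fun r => ln (x (ln r))) in hX; set (Y := fun r => ln (y (ln r))) in hY.
  change (is_derive (fun r => 1 / (q - INR k) * (ln (c_nk n k) - ln lam + X r
            + INR k * Y r - 2 * INR k * ln r - ln (rho r))) r (- (y (ln r) / r))).
  auto_derive.
  - repeat split; auto; eexists; eassumption.
  - replace (Derive (fun x => X x) r) with
      ((nu n rho (ln r) - x (ln r) - q * y (ln r)) / r)
      by (symmetry; now apply is_derive_unique).
    replace (Derive (fun x => Y x) r) with
      ((- ((INR n - 2 * INR k) / INR k) + x (ln r) / INR k + y (ln r)) / r)
      by (symmetry; now apply is_derive_unique).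
    unfold nu, rho_R; rewrite exp_ln by exact hr.
    change (Derive (fun x => rho x) r) with (Derive rho r).
    field; repeat split; lra.
Qed.

Lemma sol_derive r : 0 < r -> is_derive sol r (exp (log_w r) * (y (ln r) / r)).
Proof.
  intro hr; pose proof (log_w_derive r hr) as hd; unfold sol.
  auto_derive.
  - eexists; exact hd.
  - replace (Derive (fun x => log_w x) r) with (- (y (ln r) / r))
      by (symmetry; now apply is_derive_unique).
    ring.
Qed.

Lemma flux_sol r : 0 < r -> flux n k sol r = exp (log_flux r).
Proof.
  intro hr; unfold flux; rewrite (is_derive_unique _ _ _ (sol_derive r hr)).
  replace (exp (log_w r) * (y (ln r) / r))
    with (exp (log_w r + ln (y (ln r)) - ln r)).
  - rewrite <- (exp_ln r) at 1 by exact hr.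
    rewrite !pow_exp, <- exp_plus, minus_INR by lia.
    unfold log_flux; f_equal; ring.
  - unfold Rminus; rewrite !exp_plus, exp_Ropp, !exp_ln by auto.
    unfold Rdiv; ring.
Qed.

Lemma flux_sol_derive r : 0 < r ->
  is_derive (flux n k sol) r (exp (log_flux r) * (x (ln r) / r)).
Proof.
  intro hr; destruct (INR_facts n k hk hn) as [h1 h2].
  apply is_derive_ext_loc with (fun r => exp (log_flux r)).
  - apply filter_imp with (2 := open_gt 0 r hr); intros s hs; now rewrite flux_sol.
  - pose proof (log_w_derive r hr) as hw; pose proof (log_y_derive r hr) as hY.
    set (Y := fun r => ln (y (ln r))) in hY.
    change (is_derive (fun r => exp ((INR n - 2 * INR k) * ln r + INR k * log_w r
              + INR k * Y r)) r (exp (log_flux r) * (x (ln r) / r))).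
    auto_derive.
    + repeat split; auto; eexists; eassumption.
    + replace (Derive (fun x => log_w x) r) with (- (y (ln r) / r))
        by (symmetry; now apply is_derive_unique).
      replace (Derive (fun x => Y x) r) with
        ((- ((INR n - 2 * INR k) / INR k) + x (ln r) / INR k + y (ln r)) / r)
        by (symmetry; now apply is_derive_unique).
      change (exp ((INR n - 2 * INR k) * ln r + INR k * log_w r + INR k * Y r))
        with (exp (log_flux r)).
      field; lra.
Qed.

Lemma sol_equation r : 0 < r ->
  c_nk n k * powerRZ r (1 - Z.of_nat n) * Derive (flux n k sol) r
  = lam * rho r * Rpower (1 - sol r) q.
Proof.
  intro hr.
  rewrite (is_derive_unique _ _ _ (flux_sol_derive r hr)), powerRZ_Rpower by exact hr.
  rewrite minus_IZR, <- INR_IZR_INZ.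
  replace (1 - sol r) with (exp (log_w r)) by (unfold sol; ring).
  unfold Rpower; rewrite ln_exp.
  assert (hc : 0 < c_nk n k) by (apply c_nk_pos; lia).
  rewrite <- (exp_ln (c_nk n k)), <- (exp_ln lam), <- (exp_ln (rho r)) by auto.
  replace (x (ln r) / r) with (exp (ln (x (ln r)) - ln r))
    by (unfold Rminus; rewrite exp_plus, exp_Ropp, !exp_ln by auto; reflexivity).
  rewrite <- !exp_plus; f_equal.
  replace (q * log_w r) with (INR k * log_w r + (q - INR k) * log_w r) by ring.
  replace ((q - INR k) * log_w r) with
    (ln (c_nk n k) - ln lam + ln (x (ln r)) + INR k * ln (y (ln r))
     - 2 * INR k * ln r - ln (rho r)) by (unfold log_w; field; lra).
  unfold log_flux; ring.
Qed.

Lemma sol_neg (h1 : log_w 1 = 0) r : 0 < r < 1 -> sol r < 0.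
Proof.
  intro hr.
  destruct (MVT_gen log_w r 1 (fun r => - (y (ln r) / r))) as [c [hc heq]].
  - rewrite Rmin_left by lra; intros s hs; apply log_w_derive; lra.
  - rewrite Rmin_left by lra; intros s hs; apply continuity_pt_filterlim.
    eapply continuous_of_derive, log_w_derive; lra.
  - rewrite Rmin_left in hc by lra.
    assert (0 < y (ln c) / c) by (apply Rdiv_lt_0_compat; [apply hyp | lra]).
    assert (hw : 0 < log_w r) by nra.
    unfold sol; apply exp_increasing in hw; rewrite exp_0 in hw; lra.
Qed.

Lemma sol_solves (h1 : log_w 1 = 0) : solves_P n k q rho lam sol.
Proof.
  split; [| split].
  - intros r hr; repeat split.
    + eexists; apply sol_derive; lra.
    + eexists; apply flux_sol_derive; lra.
    + apply sol_equation; lra.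
    + now apply sol_neg.
  - apply continuous_on_forall; intros r [hr _].
    eapply continuous_of_derive, sol_derive, hr.
  - unfold sol; rewrite h1, exp_0; ring.
Qed.
End Solution.

(** * Behaviour at the origin *)

Lemma lim_plus {T : Type} (F : (T -> Prop) -> Prop) {FF : Filter F} (f g : T -> R) (a b : R) :
  filterlim f F (locally a) -> filterlim g F (locally b) ->
  filterlim (fun t => f t + g t) F (locally (a + b)).
Proof.
  intros hf hg.
  exact (filterlim_comp_2 f g (fun u v => u + v) hf hg
           (filterlim_plus (K := R_AbsRing) (V := R_NormedModule) a b)).
Qed.

Lemma lim_continuous {T : Type} (F : (T -> Prop) -> Prop) (f : T -> R) (g : R -> R) (a : R) :
  filterlim f F (locally a) -> continuous g a ->
  filterlim (fun t => g (f t)) F (locally (g a)).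
Proof. intros hf hg; exact (filterlim_comp _ _ _ f g _ _ _ hf hg). Qed.

Lemma lim_log_deviation {T : Type} (F : (T -> Prop) -> Prop) {FF : Filter F}
  (f : T -> R) (a c : R) : 0 < a -> filterlim f F (locally a) ->
  filterlim (fun t => c * (ln (f t) - ln a)) F (locally 0).
Proof.
  intros ha hf.
  replace 0 with (c * (ln a - ln a)) by ring.
  apply (lim_continuous F f (fun v => c * (ln v - ln a))); [exact hf |].
  apply (continuous_scal_r (V := R_NormedModule) c (fun v => ln v - ln a)).
  apply (continuous_minus (V := R_NormedModule)); [now apply continuous_ln |].
  apply continuous_const.
Qed.

Lemma affine_ln_minus_infinity (a b : R) : 0 < a ->
  filterlim (fun r => a * ln r + b) (at_right 0) (Rbar_locally m_infty).
Proof.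
  intro ha.
  apply (filterlim_comp _ _ _ ln (fun t => a * t + b) _ (Rbar_locally m_infty)).
  - exact is_lim_ln_0.
  - intros P [M hM]; exists ((M - b) / a); intros t ht; apply hM.
    apply (Rmult_lt_compat_l a) in ht; [| exact ha].
    replace (a * ((M - b) / a)) with (M - b) in ht by (field; lra); lra.
Qed.

Lemma ln_monomial (a b c : R) (m : nat) : 0 < a -> 0 < b -> 0 < c ->
  ln (a * b * c ^ m) = ln a + ln b + INR m * ln c.
Proof.
  intros ha hb hc.
  rewrite ln_mult, ln_mult, ln_pow; auto using pow_lt, Rmult_lt_0_compat.
Qed.

(** In the next two lemmas [lA + theta r - a * ln r] is the logarithm of
    [w = 1 - u]: the leading term of [w] is [exp lA * r^(- a)], and the remaining
    factor [exp (theta r)] tends to [1]. *)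
Lemma singular_of_log_profile (a lA : R) (theta u : R -> R) (ha : 0 < a)
  (htheta : filterlim theta (at_right 0) (locally 0))
  (hu : forall r, 0 < r -> u r = 1 - exp (lA + theta r - a * ln r)) :
  filterlim u (at_right 0) (Rbar_locally m_infty).
Proof.
  intros P [M hM].
  assert (h1 : at_right 0 (fun r => -1 < theta r)).
  { apply htheta; exists (mkposreal 1 Rlt_0_1); intros v hv.
    change (Rabs (v - 0) < 1) in hv; apply Rabs_def2 in hv; lra. }
  assert (h2 : at_right 0 (fun r => a * ln r + (1 - lA) < M)).
  { apply (affine_ln_minus_infinity a (1 - lA) ha (fun v => v < M)); exists M; auto. }
  assert (h3 : at_right 0 (fun r => 0 < r))
    by (apply at_right_0_of_interval with 1; intros; lra).
  apply filter_imp with (2 := filter_and _ _ h1 (filter_and _ _ h2 h3)).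
  intros r [h1r [h2r h3r]]; apply hM; rewrite hu by exact h3r.
  pose proof (exp_ineq1_le (lA + theta r - a * ln r)); lra.
Qed.

Lemma asymptotics_of_log_profile (a lA : R) (theta u : R -> R) (ha : 0 < a)
  (htheta : filterlim theta (at_right 0) (locally 0))
  (hu : forall r, 0 < r -> u r = 1 - exp (lA + theta r - a * ln r)) :
  exists eps : R -> R, filterlim eps (at_right 0) (locally 0) /\
    forall r, 0 < r < 1 -> u r = - exp lA * Rpower r (- a) * (1 + eps r).
Proof.
  (* [eps = w / (exp lA * r^(- a)) - r^a / exp lA - 1] *)
  exists (fun r => exp (theta r) + (- 1 * exp (a * ln r + (- lA)) + - 1)); split.
  - assert (h0 : exp 0 + (- 1 * 0 + - 1) = 0) by (rewrite exp_0; ring).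
    rewrite <- h0 at 2.
    apply lim_plus; [typeclasses eauto | |].
    + apply lim_continuous; [exact htheta | apply continuous_exp].
    + apply lim_plus; [typeclasses eauto | | apply filterlim_const].
      apply (lim_continuous _ (fun r => exp (a * ln r + - lA)) (fun v => - 1 * v)).
      * exact (filterlim_comp _ _ _ _ exp _ _ _ (affine_ln_minus_infinity a (- lA) ha)
                 is_lim_exp_m).
      * apply (continuous_scal_r (V := R_NormedModule) (- 1) (fun v => v)).
        apply continuous_id.
  - intros r hr; rewrite hu by lra; unfold Rpower.
    unfold Rminus; rewrite !exp_plus, !exp_Ropp.
    replace (- a * ln r) with (- (a * ln r)) by ring; rewrite exp_Ropp.
    pose proof (exp_pos lA); pose proof (exp_pos (a * ln r)).
    field; lra.
Qed.

Theorem proposition3p4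
  (n k : nat) (q : R) (rho : R -> R) (l0 : R)
  (x y : R -> R) (T : Rbar)
  (hk : (0 < k)%nat) (hn : (2 * k < n)%nat) (hq : INR k < q)
  (rho_C2 : C2_pos rho)
  (rho_cont : continuous_on (fun r => 0 <= r) rho)
  (rho_pos : forall r, 0 < r -> 0 < rho r)
  (hl0 : filterlim (rho_R rho) (at_right 0) (locally l0))
  (ha : ((forall r, 0 < r -> rho_R rho r < l0) /\ q_star n k l0 <= q) \/
        ((forall r, 0 < r -> rho_R rho r <= l0) /\ q_star n k l0 < q))
  (hb : exists L, 0 < L /\ forall r, 0 < r -> 0 < rho_K rho l0 r < L)
  (hxy : maximal_trajectory n k q rho x y T)
  (hx : is_lim x m_infty (x_hat n k q l0))
  (hy : is_lim y m_infty (y_hat k q l0)) :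
  Rbar_lt 0 T /\
  exists K0 : R,
    filterlim (rho_K rho l0) (at_right 0) (locally K0) /\ 0 < K0 /\
    exists u : R -> R,
      singular_solution n k q rho (lambda_tilde n k rho x y) u /\
      exists eps : R -> R,
        filterlim eps (at_right 0) (locally 0) /\
        forall r, 0 < r < 1 ->
          u r =
            - Rpower (c_nk n k * x_hat n k q l0 * y_hat k q l0 ^ k
                        / (lambda_tilde n k rho x y * K0))
                     (1 / (q - INR k))
              * Rpower r (- ((2 * INR k + l0) / (q - INR k)))
              * (1 + eps r).
Proof.
  assert (hR : forall r, 0 < r -> rho_R rho r <= l0).
  { destruct ha as [[h _] | [h _]]; intros r hr; specialize (h r hr); lra. }
  assert (hqs : q_star n k l0 <= q) by (destruct ha as [[_ h] | [_ h]]; lra).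
  assert (hl0' : 0 <= l0) by (eapply l0_nonneg; eassumption).
  assert (hT : T = p_infty) by (eapply trajectory_global; eassumption).
  subst T; split; [exact I |].
  destruct hxy as [_ [hsol _]].
  assert (hxp : forall t, 0 < x t) by (intro t; eapply x_pos; try eassumption; exact I).
  assert (hyp : forall t, 0 < y t) by (intro t; eapply y_pos; try eassumption; exact I).
  destruct hb as [L [_ hL]].
  destruct (antitone_bounded_limit (rho_K rho l0) L) as [K0 [hK0 hK0pos]];
    [intros r s hr hrs; now apply rho_K_antitone | exact hL |].
  exists K0; split; [exact hK0 |]; split; [exact hK0pos |].
  set (lam := lambda_tilde n k rho x y).
  destruct (INR_facts n k hk hn) as [h1 h2].
  assert (hc : 0 < c_nk n k) by (apply c_nk_pos; lia).
  assert (hr1 : 0 < rho 1) by (apply rho_pos; lra).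
  assert (hyk : 0 < y 0 ^ k) by (apply pow_lt, hyp).
  assert (hlam : 0 < lam).
  { apply Rdiv_lt_0_compat; [| exact hr1].
    apply Rmult_lt_0_compat; [apply Rmult_lt_0_compat; auto | exact hyk]. }
  assert (hxh : 0 < x_hat n k q l0) by (eapply x_hat_pos; eassumption).
  assert (hyh : 0 < y_hat k q l0) by (eapply y_hat_pos; eassumption).
  assert (hw1 : log_w n k q rho x y lam 1 = 0).
  { unfold log_w; rewrite ln_1.
    (* this is where the value [lambda_tilde] enters *)
    assert (hln : ln lam = ln (c_nk n k) + ln (x 0) + INR k * ln (y 0) - ln (rho 1)).
    { unfold lam, lambda_tilde.
      rewrite ln_div; [| auto using Rmult_lt_0_compat | exact hr1].
      rewrite ln_monomial by auto; reflexivity. }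
    rewrite hln; field; lra. }
  set (a := (2 * INR k + l0) / (q - INR k)).
  assert (ha0 : 0 < a) by (apply Rdiv_lt_0_compat; lra).
  set (lA := 1 / (q - INR k) *
         ln (c_nk n k * x_hat n k q l0 * y_hat k q l0 ^ k / (lam * K0))).
  set (theta := fun r =>
         1 / (q - INR k) * (ln (x (ln r)) - ln (x_hat n k q l0))
         + (1 / (q - INR k) * INR k * (ln (y (ln r)) - ln (y_hat k q l0))
            + - (1 / (q - INR k)) * (ln (rho_K rho l0 r) - ln K0))).
  assert (htheta : filterlim theta (at_right 0) (locally 0)).
  { replace 0 with (0 + (0 + 0)) at 2 by ring.
    repeat (apply lim_plus; [typeclasses eauto | |]); apply lim_log_deviation;
      auto; try typeclasses eauto.
    - exact (filterlim_comp _ _ _ ln x _ _ _ is_lim_ln_0 hx).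
    - exact (filterlim_comp _ _ _ ln y _ _ _ is_lim_ln_0 hy). }
  assert (hu : forall r, 0 < r ->
            sol n k q rho x y lam r = 1 - exp (lA + theta r - a * ln r)).
  { intros r hr; unfold sol; do 2 f_equal.
    assert (hyhk : 0 < y_hat k q l0 ^ k) by now apply pow_lt.
    unfold log_w, theta, lA, rho_K, Rpower, a.
    rewrite ln_div; [| auto using Rmult_lt_0_compat
                     | apply Rmult_lt_0_compat; auto].
    rewrite ln_monomial, (ln_mult lam K0), (ln_mult (exp _)), ln_exp
      by auto using exp_pos.
    field; lra. }
  exists (sol n k q rho x y lam); split.
  - split.
    + now apply sol_solves.
    + exact (singular_of_log_profile a lA theta _ ha0 htheta hu).
  - exact (asymptotics_of_log_profile a lA theta _ ha0 htheta hu).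
Qed.
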